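(* Let $p>2$ be a prime and let $r\ge 1$ be an integer. Let $x,c$ be indeterminates over $\mathbb{Q}_p$, and let $c_1,\dots,c_r$ (in a splitting field over $\mathbb{Q}_p(x)$) satisfy $x(c-1)^r+c^{r-1}=x\prod_{i=1}^r(c-c_i)$. Then $$\sum_{0<k<p}\binom{rk}{k}x^k\equiv x^p\sum_{i=1}^r\frac{r}{r-1+c_i}\bigl(r-1-(r-1)c_i^p-r(1-c_i)^p\bigr)\pmod{p^2}.$$
   Context: Here $\mathbb{Q}_p$ is the field of $p$-adic numbers. Interpretation of the congruence: both sides are symmetric in $c_1,\dots,c_r$ and hence lie in $\mathbb{Q}_p(x)$; for $A,B\in\mathbb{Q}_p(x)$, $A\equiv B\pmod{p^n}$ means $A-B\in p^nR$, where $R$ is the valuation ring of $\mathbb{Q}_p(x)$ with respect to the $p$-adic (Gauss) valuation, i.e. the valuation extending $v_p$ with $v(\sum_j a_jx^j)=\min_j v_p(a_j)$ on polynomials.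
   Formalization: The formal theorem assumes r ≥ 2 instead of r ≥ 1: for r = 1 we get c_1 = 1 − 1/x, and the two sides differ by −x^p/(1−x), which has Gauss valuation 0, so the congruence fails for every p. *)

(* Defs.v *)
From HB Require Import structures.
From mathcomp Require Import all_boot all_order all_algebra all_field.
From mathcomp Require Import boolp constructive_ereal.

Set Implicit Arguments.
Unset Strict Implicit.
Unset Printing Implicit Defensive.

Import Order.TTheory GRing.Theory Num.Theory.
Local Open Scope ring_scope.

(** * The p-adic integers, as the inverse limit of the rings Z/p^n *)

(* An element is the coherent sequence of its residues mod p^n, each taken in
   [0, p^n[: the equation below says both that the residue mod p^n.+1 reduces
   to the residue mod p^n and that the latter is the canonical one.  The
   primality proof is a parameter of the type so that the integral domain
   structure can be inferred. *)
Record padic_int (p : nat) (p_pr : prime p) := PadicInt {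
  residue :> nat -> int;
  _ : forall n, (residue n.+1 %% p%:Z ^+ n)%Z = residue n
}.

Section PadicInt.
Variables (p : nat) (p_pr : prime p).
Local Notation Zp := (padic_int p_pr).
Implicit Types a b : Zp.

HB.instance Definition _ := gen_eqMixin Zp.
HB.instance Definition _ := gen_choiceMixin Zp.

Lemma residueS a n : (a n.+1 %% p%:Z ^+ n)%Z = a n.
Proof. by case: a. Qed.

Lemma padic_int_ext a b : a =1 b -> a = b.
Proof.
case: a b => [f hf] [g hg] /= /funext fg.
by case: _ / fg hg => hg; rewrite (Prop_irrelevance hf hg).
Qed.

Lemma modz_exp_le (m : int) i n : (i <= n)%N ->
  ((m %% p%:Z ^+ n)%Z %% p%:Z ^+ i)%Z = (m %% p%:Z ^+ i)%Z.
Proof.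
move=> le_in; rewrite [in RHS](divz_eq m (p%:Z ^+ n)).
have -> : p%:Z ^+ n = p%:Z ^+ (n - i) * p%:Z ^+ i by rewrite -exprD subnK.
by rewrite [in RHS]mulrA modzMDl.
Qed.

Lemma residue_modz a n : (a n %% p%:Z ^+ n)%Z = a n.
Proof. by rewrite -[in LHS]residueS modz_mod residueS. Qed.

Lemma residue_le a m n : (m <= n)%N -> (a n %% p%:Z ^+ m)%Z = a m.
Proof.
move=> /subnK <-; elim: (n - m)%N => [|k IHk]; first exact: residue_modz.
by rewrite -(modz_exp_le _ (leq_addl k m)) addSn residueS.
Qed.

(* The p-adic integer with residues F n, for F coherent modulo p^n. *)
Definition of_residues (F : nat -> int)
  (cF : forall n, (F n.+1 = F n %[mod p%:Z ^+ n])%Z) : Zp :=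
  PadicInt p_pr (fun n => etrans (modz_exp_le _ (leqnSn n)) (cF n)).

Fact cst_coherent (m : int) n : (m = m %[mod p%:Z ^+ n])%Z.
Proof. by []. Qed.

Fact opp_coherent a n : (- a n.+1 = - a n %[mod p%:Z ^+ n])%Z.
Proof. by rewrite -modzNm residueS. Qed.

Fact add_coherent a b n :
  (a n.+1 + b n.+1 = a n + b n %[mod p%:Z ^+ n])%Z.
Proof. by rewrite -modzDm !residueS. Qed.

Fact mul_coherent a b n :
  (a n.+1 * b n.+1 = a n * b n %[mod p%:Z ^+ n])%Z.
Proof. by rewrite -modzMm !residueS. Qed.

Definition padic_int_of_int (m : int) := of_residues (cst_coherent m).
Definition padic_int_opp a := of_residues (opp_coherent a).
Definition padic_int_add a b := of_residues (add_coherent a b).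
Definition padic_int_mul a b := of_residues (mul_coherent a b).

Fact padic_int_addA : associative padic_int_add.
Proof.
by move=> a b c; apply: padic_int_ext => n /=; rewrite modzDmr modzDml addrA.
Qed.

Fact padic_int_addC : commutative padic_int_add.
Proof. by move=> a b; apply: padic_int_ext => n /=; rewrite addrC. Qed.

Fact padic_int_add0 : left_id (padic_int_of_int 0) padic_int_add.
Proof.
by move=> a; apply: padic_int_ext => n /=; rewrite modzDml add0r residue_modz.
Qed.

Fact padic_int_addN :
  left_inverse (padic_int_of_int 0) padic_int_opp padic_int_add.
Proof.
by move=> a; apply: padic_int_ext => n /=; rewrite modzDml addNr.
Qed.

HB.instance Definition _ := GRing.isZmodule.Build Zp
  padic_int_addA padic_int_addC padic_int_add0 padic_int_addN.

Fact padic_int_mulA : associative padic_int_mul.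
Proof.
by move=> a b c; apply: padic_int_ext => n /=; rewrite modzMmr modzMml mulrA.
Qed.

Fact padic_int_mulC : commutative padic_int_mul.
Proof. by move=> a b; apply: padic_int_ext => n /=; rewrite mulrC. Qed.

Fact padic_int_mul1 : left_id (padic_int_of_int 1) padic_int_mul.
Proof.
by move=> a; apply: padic_int_ext => n /=; rewrite modzMml mul1r residue_modz.
Qed.

Fact padic_int_mulD : left_distributive padic_int_mul +%R.
Proof.
move=> a b c; apply: padic_int_ext => n /=.
by rewrite modzMml modzDm mulrDl.
Qed.

Fact padic_int_1_neq0 : padic_int_of_int 1 != 0.
Proof.
apply/eqP => /(congr1 (fun a : Zp => a 1%N)) /=.
by rewrite expr1 mod0z modz_small // ltz_nat prime_gt1.
Qed.

HB.instance Definition _ := GRing.Zmodule_isComNzRing.Build Zp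
  padic_int_mulA padic_int_mulC padic_int_mul1 padic_int_mulD padic_int_1_neq0.

Definition padic_int_unit : {pred Zp} := fun a => `[< exists b, b * a = 1 >].

Definition padic_int_inv a : Zp :=
  if pselect (exists b, b * a = 1) is left h then sval (cid h) else a.

Fact padic_int_mulVr : {in padic_int_unit, left_inverse 1 padic_int_inv *%R}.
Proof.
move=> a /asboolP ua; rewrite /padic_int_inv; case: pselect => // h.
exact: (svalP (cid h)).
Qed.

Fact padic_int_unitPl a b : b * a = 1 -> padic_int_unit a.
Proof. by move=> ba1; apply/asboolP; exists b. Qed.

Fact padic_int_inv_out : {in [predC padic_int_unit], padic_int_inv =1 id}.
Proof.
move=> a /asboolPn nua; rewrite /padic_int_inv; by case: pselect.
Qed.

HB.instance Definition _ := GRing.ComNzRing_hasMulInverse.Build Zp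
  padic_int_mulVr padic_int_unitPl padic_int_inv_out.

Lemma residue0 n : (0 : Zp) n = 0. Proof. exact: mod0z. Qed.

Lemma padic_int_neq0 a : a <> 0 -> exists n, a n != 0.
Proof.
move=> /eqP a_neq0; apply/not_existsP => a0; move/eqP: a_neq0; apply.
by apply: padic_int_ext => n; rewrite residue0; apply/eqP/negPn/negP/a0.
Qed.

Lemma pexp_dvdzM (u v : int) i j : (p%:Z ^+ (i + j) %| u * v)%Z ->
  (p%:Z ^+ i %| u)%Z || (p%:Z ^+ j %| v)%Z.
Proof.
have [->|u0] := eqVneq u 0; first by rewrite dvdz0.
have [->|v0] := eqVneq v 0; first by rewrite dvdz0 orbT.
rewrite !dvdzE !abszX /= abszM.
rewrite !pfactor_dvdn ?muln_gt0 ?absz_gt0 ?u0 ?v0 // lognM ?absz_gt0 //.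
case: (leqP i) => //= ui; apply: contraLR; rewrite -!ltnNge => vj.
by rewrite -addSn leq_add // ltnW.
Qed.

Fact padic_int_idomain a b : a * b = 0 -> (a == 0) || (b == 0).
Proof.
move=> ab0; apply/orP; apply: contrapT.
rewrite not_orE => -[/negP/eqP a0 /negP/eqP b0].
have [i /eqP ai] := padic_int_neq0 a0; have [j /eqP bj] := padic_int_neq0 b0.
have /= := congr1 (fun c : Zp => c (i + j)%N) ab0.
rewrite mod0z => /dvdz_mod0P /pexp_dvdzM /orP[] /dvdz_mod0P.
  by rewrite residue_le ?leq_addr.
by rewrite residue_le ?leq_addl.
Qed.

HB.instance Definition _ :=
  GRing.ComUnitRing_isIntegral.Build Zp padic_int_idomain.

(* As the residue mod p^0 is always 0, the valuation is the least n such that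
   the residue mod p^n.+1 is nonzero. *)
Definition padic_int_val a : \bar int :=
  if pselect (exists n, a n.+1 != 0) is left h then (Posz (ex_minn h))%:E
  else +oo%E.

End PadicInt.

(** * Fraction fields and valuations *)

(* The extension v(n / d) = v n - v d of a valuation to the fraction field;
   it does not depend on the chosen representative when v is a valuation. *)
Definition frac_val (D : idomainType) (v : D -> \bar int) (u : {fraction D}) :
  \bar int := (v \n_(repr u) - v \d_(repr u))%E.

Definition poly_min_val (K : fieldType) (v : K -> \bar int) (f : {poly K}) :
  \bar int := \big[Order.min/+oo%E]_(j < size f) v f`_j.

Section GaussValuation.
Variables (p : nat) (p_pr : prime p).

Definition padic : fieldType := {fraction padic_int p_pr}.

Definition padic_val : padic -> \bar int := frac_val (@padic_int_val p p_pr).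

Definition padic_ratfun : fieldType := {fraction {poly padic}}.

Definition gauss_val : padic_ratfun -> \bar int :=
  frac_val (poly_min_val padic_val).

(* A = B (mod p^n), i.e. A - B lies in p^n R for R the valuation ring. *)
Definition gauss_eqmod (n : nat) (A B : padic_ratfun) : Prop :=
  exists2 C : padic_ratfun, (0%:E <= gauss_val C)%E & A - B = p%:R ^+ n * C.

Definition ratfun_X : padic_ratfun := tofrac 'X.

(* x (c - 1)^r + c^(r - 1) as a polynomial in c, with x = ratfun_X. *)
Definition branch_poly (r : nat) : {poly padic_ratfun} :=
  ratfun_X *: ('X - 1) ^+ r + 'X^(r.-1).

End GaussValuation.

(* Main.v *)
Require Import Defs.
From mathcomp Require Import all_boot all_order all_algebra all_field ring.
From mathcomp Require Import boolp constructive_ereal.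

Import Order.TTheory GRing.Theory Num.Theory.
Local Open Scope ring_scope.

(** Why the congruence holds.  Put a = r - 1 and t = -1/c.  The equation of the
    c_i becomes D(t) = 0 for
      D(t) = x (1 + t)^r - t = x prod_i (1 + c_i t)
    (reverse_factorization).  Let
      W_m = sum_i (- c_i)^m / (a + c_i)
    be the power sums of the c_i, weighted as in the statement.  Their
    generating series is a rational function of t and x,
      sum_m W_m t^m = (x (1 + t)^a - t) / D(t)
    (weighted_sum_den_without, wpsum_series), so W_0 = 1 and x^m W_m is a
    polynomial in x with integer coefficients (image_of_wpsum).

    As x^p (1 + t)^(rp) = (D(t) + t)^p, the coefficient of t^p in
    (1 + t)^(rp) sum_m W_m t^m can be computed exactly, and the result
    telescopes (sum_bin_wpsum):
      r x^p sum_j C(rp, j) W_(p-j) = a C(rp, p) x^p - sum_(0<k<p) C(rk, k) x^k.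
    On the other hand, for p odd, expanding (1 - c_i)^p shows that the
    right-hand side of the congruence is
      r x^p (a + a W_p - r sum_j C(p, j) W_(p-j)).
    Now C(rp, j) = r C(p, j) modulo p^2 for 0 < j <= p (bin_mul_prime_modp2),
    so both sides differ by p^2 times an integer combination of x^p and of the
    x^p W_m with m < p, that is, by p^2 g(x) with g an integer polynomial
    (root_sum_congruence).

    It remains to see that g(x) has nonnegative Gauss valuation
    (gauss_val_int_poly).  The valuation of a fraction is computed on a
    representative n / d that need not be g / 1, but n = g d, and the
    ultrametric inequality on coefficients gives v(g d) >= v(d). *)

(** * Binomial coefficients modulo p^2 *)

(** By induction on r: in the Vandermonde expansion of the binomial coefficient
    of p + r * p over j, each inner term is a product of two binomial
    coefficients that are both divisible by p, so only the two end terms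
    survive modulo p ^ 2. *)
Lemma bin_mul_prime_modp2 p r j : prime p -> (0 < j <= p)%N ->
  'C(r * p, j) = (r * 'C(p, j))%N %[mod p ^ 2].
Proof.
move=> p_pr; elim: r j => [|r IHr] j /andP[j0 jp].
  by rewrite !mul0n bin0n; case: j j0 jp.
have dvd_p i : (0 < i < p)%N -> (p %| 'C(r * p, i))%N.
  move=> /andP[i0 ip]; have p_p2 : (p %| p ^ 2)%N by rewrite dvdn_mulr.
  have IHi : 'C(r * p, i) = (r * 'C(p, i))%N %[mod p ^ 2].
    by apply: IHr; rewrite i0 ltnW.
  rewrite /dvdn -(modn_dvdm _ p_p2) IHi (modn_dvdm _ p_p2).
  by apply: dvdn_mull; apply: prime_dvd_bin; rewrite ?i0.
rewrite mulSn addnC -binomial.Vandermonde -(prednK j0).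
rewrite big_ord_recl big_ord_recr /= bin0 mul1n subn0 /bump leq0n add1n.
rewrite prednK // subnn bin0 muln1 addnCA addnC.
have /dvdnP[q ->] : (p ^ 2 %| \sum_(i < j.-1) 'C(r * p, bump 0 i) *
                        'C(p, j - bump 0 i))%N.
  apply: dvdn_sum => i _; have lt_i := ltn_ord i.
  have i1j : (i.+1 < j)%N by rewrite -ltn_predRL.
  rewrite dvdn_mul ?dvd_p ?prime_dvd_bin // /bump leq0n add1n.
    by rewrite ltn0Sn (leq_trans i1j jp).
  by rewrite subn_gt0 i1j (leq_trans _ jp) // ltn_subrL.
by rewrite addnC modnMDl -modnDmr IHr ?j0 // modnDmr mulSn.
Qed.

(** The same congruence with its quotient made explicit, so that it can be
    summed in any ring. *)
Lemma bin_mul_primeE (R : nzRingType) p r j : prime p -> (0 < j <= p)%N ->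
  'C(r * p, j)%:R = r%:R * 'C(p, j)%:R + p%:R ^+ 2 *
    (('C(r * p, j)%:Z - (r * 'C(p, j))%N%:Z) %/ (p ^ 2)%N%:Z)%Z%:~R :> R.
Proof.
move=> p_pr j_p; have /(congr1 Posz) := bin_mul_prime_modp2 p r j p_pr j_p.
rewrite -!modz_nat => /eqP; rewrite eqz_mod_dvd => /divzK e.
move/(congr1 (fun z : int => z%:~R : R)): e.
rewrite rmorphM rmorphB /= -!pmulrn => e.
by rewrite -natrM -natrX (commr_sym (commr_nat _ _)) e addrC subrK.
Qed.

(** This identity makes the sum of [sum_bin_wpsum] telescope. *)
Lemma bin_mulS a k :
  (a.+1 * 'C(a.+1 * k + a, k.+1))%N = (a * 'C(a.+1 * k.+1, k.+1))%N.
Proof.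
apply/eqP; rewrite -(eqn_pmul2l (ltn0Sn k)) mulnCA mulnA [X in _ == X]mulnA.
have -> : (a.+1 * k + a)%N = (a.+1 * k.+1).-1 by rewrite mulnS addnC.
by rewrite mul_bin_down -{2}[k.+1]mul1n -mulnBl subn1 /= [(k.+1 * a)%N]mulnC.
Qed.

(** * Products of polynomials and their reversal *)

Lemma deriv_prod (R : comNzRingType) (I : eqType) (s : seq I)
    (F : I -> {poly R}) : uniq s ->
  (\prod_(i <- s) F i)^`() =
    \sum_(i <- s) (F i)^`() * \prod_(j <- s | j != i) F j.
Proof.
elim: s => [_|k s IHs /= /andP[k_s uniq_s]].
  by rewrite !big_nil -polyC1 derivC.
rewrite !big_cons eqxx derivM IHs //; congr (_ * _ + _).
  rewrite big_seq [RHS]big_seq_cond; apply: eq_bigl => j.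
  by case: eqP => [->|]; rewrite ?andbT // (negPf k_s).
rewrite mulr_sumr !big_seq; apply: eq_bigr => i i_s; rewrite big_cons.
by rewrite (memPnC k_s) // mulrCA.
Qed.

(** S is the power series M / E up to degree n.  As E divides
    (E + 'X) ^+ n - 'X^n, the product E * S = M replaces S in all but one
    term. *)
Lemma exp_addX_mul {R : comNzRingType} {E S M Q : {poly R}} {n : nat} :
    E * S = M - 'X^(n.+1) * Q ->
  (E + 'X) ^+ n * S = 'X^n * S +
    \sum_(k < n) (E + 'X) ^+ (n.-1 - k) * M * 'X^k
    - (\sum_(k < n) (E + 'X) ^+ (n.-1 - k) * 'X^k) * Q * 'X^(n.+1).
Proof.
move=> ES; rewrite -[(E + 'X) ^+ n in LHS](subrK 'X^n) mulrDl [LHS]addrC -addrA.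
congr (_ + _); rewrite subrXX addrK mulrAC ES mulrBl; congr (_ - _).
  by rewrite mulr_sumr; apply: eq_bigr => k _; rewrite mulrA [M * _]mulrC.
by rewrite [RHS]mulrC [RHS]mulrA mulrAC.
Qed.

Lemma coef_1X_exp (R : comNzRingType) m j :
  ((1 + 'X) ^+ m : {poly R})`_j = 'C(m, j)%:R.
Proof.
rewrite addrC exprD1n; under eq_bigr => i _ do rewrite -mulr_natr -polyC_natr.
rewrite coef_sum; under eq_bigr => i _ do rewrite coefMC coefXn.
have [le_jm|lt_mj] := leqP j m; last first.
  rewrite bin_small // big1 // => i _.
  by rewrite gtn_eqF ?mul0r // (leq_ltn_trans _ lt_mj) // -ltnS.
rewrite (bigD1 (Ordinal (le_jm : (j < m.+1)%N))) //= eqxx mul1r.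
rewrite big1 ?addr0 // => i.
by rewrite -val_eqE /= eq_sym => /negPf ->; rewrite mul0r.
Qed.

(** Evaluation at - T^-1 followed by multiplication by (- T) ^+ n.+1 reverses a
    polynomial of degree n.+1. *)
Lemma reverse_factorization_at (L F : fieldType) (f : {rmorphism L -> F})
    (T : F) (x : L) n (c : 'I_n.+1 -> L) : T != 0 ->
  x *: ('X - 1) ^+ n.+1 + 'X^n = x *: \prod_(i < n.+1) ('X - (c i)%:P) ->
  f x * (1 + T) ^+ n.+1 - T = f x * \prod_(i < n.+1) (1 + f (c i) * T).
Proof.
move=> T0 /(congr1 (fun q => (- T) ^+ n.+1 * (map_poly f q).[- T^-1])).
rewrite rmorphD /= !map_polyZ !rmorphXn rmorph_prod /= rmorphB /= rmorph1.
rewrite map_polyX hornerD !hornerZ !horner_exp hornerD hornerN hornerX hornerC.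
rewrite horner_prod mulrDr !mulrA ![_ * f x]mulrC -!mulrA -exprMn.
have -> : - T * (- T^-1 - 1) = 1 + T by field.
have -> : (- T) ^+ n.+1 * (- T^-1) ^+ n = - T.
  by rewrite exprS -mulrA -exprMn mulrNN divff // expr1n mulr1.
move=> ->; congr (_ * _); rewrite -[in X in X * _](card_ord n.+1) -prodr_const.
rewrite -big_split; apply: eq_bigr => i _ /=.
rewrite rmorphB /= map_polyX map_polyC hornerD hornerN hornerX hornerC /=.
by field.
Qed.

(** The previous lemma at the generic point of the line. *)
Lemma reverse_factorization (L : fieldType) (x : L) n (c : 'I_n.+1 -> L) :
  x *: ('X - 1) ^+ n.+1 + 'X^n = x *: \prod_(i < n.+1) ('X - (c i)%:P) ->
  x *: (1 + 'X) ^+ n.+1 - 'X = x *: \prod_(i < n.+1) (1 + c i *: 'X).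
Proof.
pose T : {fraction {poly L}} := FracField.tofrac 'X => E.
have T0 : T != 0 by rewrite tofrac_eq0 polyX_eq0.
apply/eqP; rewrite -tofrac_eq -!mul_polyC; apply/eqP.
rewrite tofracB !tofracM tofracXn tofracD tofrac1 rmorph_prod /=.
rewrite (reverse_factorization_at _ _
  (@FracField.tofrac {poly L} \o @polyC L)%FUN T x n c T0 E) /=.
congr (_ * _); apply: eq_bigr => i _.
by rewrite -mul_polyC tofracD tofracM tofrac1.
Qed.

(** * Values of integer polynomials *)

Section Image.
Context {R S : nzRingType} (f : {rmorphism R -> S}).

Definition image_of y := exists u, y = f u.

Lemma image_ofD y z : image_of y -> image_of z -> image_of (y + z).
Proof. by move=> [u ->] [v ->]; exists (u + v); rewrite rmorphD. Qed.

Lemma image_ofM y z : image_of y -> image_of z -> image_of (y * z).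
Proof. by move=> [u ->] [v ->]; exists (u * v); rewrite rmorphM. Qed.

Lemma image_of_int (m : int) : image_of m%:~R.
Proof. by exists m%:~R; rewrite rmorph_int. Qed.

Lemma image_ofB y z : image_of y -> image_of z -> image_of (y - z).
Proof. by move=> [u ->] [v ->]; exists (u - v); rewrite rmorphB. Qed.

Lemma image_ofX y n : image_of y -> image_of (y ^+ n).
Proof. by move=> [u ->]; exists (u ^+ n); rewrite rmorphXn. Qed.

Lemma image_of_sum I (r : seq I) (P : pred I) (F : I -> S) :
  (forall i, P i -> image_of (F i)) -> image_of (\sum_(i <- r | P i) F i).
Proof. by apply: big_ind; [exact: (image_of_int 0) | exact: image_ofD]. Qed.

End Image.

(** * Weighted power sums of the roots *)

Section Series.
Context {L : fieldType} {x : L} {a : nat} {c : 'I_a.+1 -> L}.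
Hypotheses (x0 : x != 0) (a0 : a%:R != 0 :> L).
Hypothesis ac0 : forall i, a%:R + c i != 0.
(* den is the reversal of x (c - 1)^(a+1) + c^a, with roots - 1 / c i, and
   den_without i is den / (1 + c i *: 'X). *)
Let den : {poly L} := x *: (1 + 'X) ^+ a.+1 - 'X.
Hypothesis den_fact : den = x *: \prod_(i < a.+1) (1 + c i *: 'X).
Let num : {poly L} := x *: (1 + 'X) ^+ a - 'X.
Let den_without i : {poly L} := x *: \prod_(j < a.+1 | j != i) (1 + c j *: 'X).

Lemma den_without_mul i : (1 + c i *: 'X) * den_without i = den.
Proof. by rewrite den_fact (bigD1 i) //= -scalerAr. Qed.

Lemma deriv_den : den^`() = \sum_i c i *: den_without i.
Proof.
rewrite den_fact derivZ.
have -> : (\prod_(i < a.+1) (1 + c i *: 'X))^`() =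
   \sum_i (c i *: \prod_(j < a.+1 | j != i) (1 + c j *: 'X)).
  rewrite deriv_prod ?index_enum_uniq //; apply: eq_bigr => i _.
  by rewrite -polyC1 derivD derivC add0r derivZ derivX -scalerAl mul1r.
by rewrite scaler_sumr; apply: eq_bigr => i _; rewrite !scalerA mulrC.
Qed.

(** Write 1 as (1 + c i *: 'X) - c i *: 'X in each term. *)
Lemma sum_den_without : \sum_i den_without i = den *+ a.+1 - 'X * den^`().
Proof.
rewrite deriv_den mulr_sumr -[X in den *+ X](card_ord a.+1) -sumr_const -sumrB.
apply: eq_bigr => i _; rewrite -(den_without_mul i) -!mul_polyC; ring.
Qed.

Lemma num_deriv_den :
  den - 'X * (den *+ a.+1 - 'X * den^`()) = (1 - a%:R *: 'X) * num.
Proof.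
have -> : den^`() = (1 + a%:R) * (x%:P * (1 + 'X) ^+ a) - 1.
  rewrite /den derivB derivZ deriv_exp derivX derivD derivX -polyC1 derivC.
  rewrite add0r polyC1 mul1r -scalerMnr mul_polyC /=.
  by rewrite -[(_ *: _) *+ _]mulr_natl mulrS.
rewrite -[den *+ _]mulr_natl mulrS /den /num exprS -!mul_polyC polyC_natr.
move: (_ ^+ a) (a%:R) => y b; ring.
Qed.

(** Multiplied by 1 - a%:R *: 'X, each term splits by the partial fraction
    (1 - a t) / ((a + c) (1 + c t)) = 1 / (a + c) - t / (1 + c t).
    The constants 1 / (a + c i) add up to 1, as evaluation at the root 1 / a of
    that factor shows. *)
Lemma weighted_sum_den_without : \sum_i (a%:R + c i)^-1 *: den_without i = num.
Proof.
pose s : L := a%:R^-1.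
have mul_den_without i : (1 - a%:R *: 'X) * ((a%:R + c i)^-1 *: den_without i) =
   (a%:R + c i)^-1 *: den - 'X * den_without i.
  have -> : 'X * den_without i =
      (a%:R + c i)^-1%:P * (a%:R + c i)%:P * ('X * den_without i).
    by rewrite -polyCM mulVf // mul1r.
  rewrite -(den_without_mul i) -!mul_polyC polyCD; ring.
have mul_sum : (1 - a%:R *: 'X) * (\sum_i (a%:R + c i)^-1 *: den_without i) =
    (\sum_i (a%:R + c i)^-1) *: den - 'X * (den *+ a.+1 - 'X * den^`()).
  rewrite mulr_sumr -sum_den_without scaler_suml mulr_sumr -sumrB.
  by apply: eq_bigr => i _; exact: mul_den_without.
have X_sum : 'X * (den *+ a.+1 - 'X * den^`()) = den - (1 - a%:R *: 'X) * num.
  by rewrite -num_deriv_den subKr.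
have den_s : den.[s] != 0.
  rewrite den_fact hornerZ horner_prod mulf_neq0 //; apply/prodf_neq0 => i _.
  rewrite !hornerE /s [c i / _]mulrC.
  by rewrite -{1}(mulVf a0) -mulrDr mulf_neq0 // invr_neq0.
have sum1 : \sum_i (a%:R + c i)^-1 = 1.
  have eval_s (U Y E : {poly L}) k :
      (1 - a%:R *: 'X) * U = k *: E - (E - (1 - a%:R *: 'X) * Y) ->
    E.[s] * (k - 1) = 0.
    move/(congr1 (horner^~ s)); rewrite !hornerE /s mulfV // subrr !mul0r subr0.
    by rewrite mulrBr mulr1 mulrC => <-.
  have /eval_s/eqP := etrans mul_sum (congr1 (fun q => _ - q) X_sum).
  by rewrite mulf_eq0 (negPf den_s) subr_eq0 => /eqP.
apply: (@mulfI _ (1 - a%:R *: 'X)).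
  apply/eqP => /(congr1 (fun q : {poly L} => q`_0)).
  rewrite coefB coefZ coefX coef1 coef0 mulr0 subr0.
  by apply/eqP; rewrite oner_neq0.
by rewrite mul_sum sum1 scale1r num_deriv_den.
Qed.

Definition wpsum m : L := \sum_i (a%:R + c i)^-1 * (- c i) ^+ m.
Let wpsum_trunc n : {poly L} := \poly_(m < n) wpsum m.

(** The generating series of the weighted power sums is num / den: expand
    1 / (1 + c i *: 'X) as a geometric series. *)
Lemma wpsum_series n : exists Q, den * wpsum_trunc n = num - 'X^n * Q.
Proof.
exists (\sum_i ((a%:R + c i)^-1 * (- c i) ^+ n) *: den_without i).
have -> : wpsum_trunc n =
    \sum_i (a%:R + c i)^-1 *: \sum_(m < n) ((- c i) *: 'X) ^+ m.
  rewrite /wpsum_trunc poly_def.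
  under eq_bigr => m _ do rewrite /wpsum scaler_suml.
  rewrite exchange_big; apply: eq_bigr => i _ /=; rewrite scaler_sumr.
  by apply: eq_bigr => m _; rewrite exprZn scalerA.
rewrite -weighted_sum_den_without !mulr_sumr -sumrB; apply: eq_bigr => i _.
pose y : {poly L} := (- c i) *: 'X; rewrite -/y.
have -> : den * ((a%:R + c i)^-1 *: \sum_(m < n) y ^+ m) =
    (a%:R + c i)^-1 *: (den_without i * (1 - y ^+ n)).
  rewrite -scalerAr -(den_without_mul i) -(opprB (y ^+ n)).
  rewrite (subrX1 y n) -mulNr opprB.
  by rewrite /y scaleNr opprK -mulrA mulrCA.
move: (den_without i) => v; rewrite /y exprZn mulrBr mulr1 scalerBr.
by rewrite -!scalerAr scalerA [v * _]mulrC.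
Qed.

Lemma wpsum0 : wpsum 0 = 1.
Proof.
have [Q] := wpsum_series 1.
move/(congr1 (fun q : {poly L} => q`_0)).
rewrite coefB coefXnM subr0 coef0M /den /num !coefB !coefZ coefX !subr0.
rewrite -!horner_coef0 !hornerE !expr1n mulr1 horner_coef0 coef_poly /= => e.
by apply: (mulfI x0); rewrite e mulr1.
Qed.

(** The left-hand side is, up to the factor a.+1, the coefficient of 'X^n in
    x ^+ n *: (1 + 'X) ^+ (a.+1 * n) * (num / den), where the first factor is
    (den + 'X) ^+ n.  Hence, apart from wpsum 0 = 1, only the powers
    (den + 'X) ^+ k times num contribute, and their coefficients are
    differences of consecutive terms
    'C(a.+1 * k, k)%:R * x ^+ k, weighted by a and a.+1. *)
Lemma sum_bin_wpsum n : (0 < n)%N ->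
  (x ^+ n * \sum_(j < n.+1) 'C(a.+1 * n, j)%:R * wpsum (n - j)) *+ a.+1 =
    a%:R * 'C(a.+1 * n, n)%:R * x ^+ n -
      \sum_(1 <= k < n) 'C(a.+1 * k, k)%:R * x ^+ k.
Proof.
move=> n0; set B := fun k => 'C(a.+1 * k, k)%:R * x ^+ k.
have [Q den_mul] := wpsum_series n.+1.
have denX : den + 'X = x *: (1 + 'X) ^+ a.+1 by rewrite subrK.
have coef_denX k :
    ((den + 'X) ^+ k * num)`_k.+1 *+ a.+1 = a%:R * B k.+1 - B k *+ a.+1.
  rewrite denX exprZn -exprM -scalerAl coefZ /num mulrBr -scalerAr -exprD.
  rewrite coefB coefZ coefMX /= !coef_1X_exp mulrBr mulrnBl; congr (_ - _).
    rewrite -!mulrnAr -[_%:R *+ _]mulr_natl -natrM bin_mulS natrM /B exprSr.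
    by rewrite mulrA mulrC mulrA.
  by rewrite /B mulrC.
have -> : x ^+ n * \sum_(j < n.+1) 'C(a.+1 * n, j)%:R * wpsum (n - j) =
    ((den + 'X) ^+ n * wpsum_trunc n.+1)`_n.
  rewrite denX exprZn -exprM -scalerAl coefZ coefM; congr (_ * _).
  apply: eq_bigr => j _; rewrite coef_1X_exp coef_poly.
  by rewrite ltnS leq_subr.
rewrite (exp_addX_mul den_mul).
rewrite coefB coefD coefMXn ltnSn subr0 coefXnM ltnn subnn coef_poly /= wpsum0.
rewrite coef_sum mulrnDl -sumrMnl.
(* Index the powers of den + 'X increasingly. *)
rewrite (reindex_inj rev_ord_inj) /=.
have -> : \sum_(k < n) ((den + 'X) ^+ (n.-1 - (n - k.+1)) * num *
     'X^(n - k.+1))`_n *+ a.+1 =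
    \sum_(0 <= k < n) (a%:R * B k.+1 - B k *+ a.+1).
  rewrite big_mkord; apply: eq_bigr => k _; have k_n := ltn_ord k.
  rewrite -coef_denX coefMXn ltnNge leq_subr /= subKn //.
  by rewrite -{2}(prednK n0) subSS subKn // -ltnS prednK.
rewrite sumrB -mulr_sumr -(big_add1 _ _ 0 n.+1 xpredT B) sumrMnl.
rewrite big_nat_recr //= (big_ltn n0).
have -> : B 0 = 1 by rewrite /B muln0 bin0 mulr1.
set S := \sum_(1 <= i < n) B i.
rewrite -[X in _ = _ - X]/S -mulrA -/(B n) -[(1 + S) *+ _]mulr_natl mulrS; ring.
Qed.

Context {f : {rmorphism {poly int} -> L}}.
Hypothesis f_x : f 'X = x.

Lemma image_of_x : image_of f x. Proof. by exists 'X. Qed.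

Lemma image_of_nat n : image_of f n%:R.
Proof. by rewrite -[n%:R]/(n%:Z%:~R); exact: image_of_int. Qed.

Lemma image_of_coef m i : image_of f (x *: (1 + 'X) ^+ m - 'X : {poly L})`_i.
Proof.
rewrite coefB coefZ coef_1X_exp coefX.
apply: image_ofB; last exact: image_of_nat.
by apply: image_ofM; [exact: image_of_x | exact: image_of_nat].
Qed.

(** Under t -> x t the fraction num / den becomes
    ((1 + x t)^a - t) / ((1 + x t)^(a+1) - t), whose denominator has constant
    term 1: its coefficients x ^+ m * wpsum m are integer polynomials in x. *)
Lemma image_of_wpsum m : image_of f (x ^+ m * wpsum m).
Proof.
have [m' le_m] := ubnP m; elim: m' m le_m => // m' IHm [|m] le_m.
  by rewrite wpsum0 mulr1 expr0; exact: (image_of_int _ 1).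
have [Q] := wpsum_series m.+2.
move/(congr1 (fun q : {poly L} => q`_m.+1)).
rewrite coefB coefXnM ltnSn subr0 coefM big_ord_recl coef_poly /= subn0 ltnSn.
have -> : den`_0 = x.
  by rewrite /den coefB coefZ coef_1X_exp coefX bin0 mulr1 subr0.
move/(canRL (addrK _)) => e; rewrite exprSr -mulrA e mulrBr mulr_sumr.
apply: image_ofB.
  by apply: image_ofM; [exact/image_ofX/image_of_x | exact: image_of_coef].
apply: image_of_sum => i _; have le_i : (i <= m)%N by rewrite -ltnS.
rewrite coef_poly /bump leq0n add1n subSS ltnS (leq_trans (leq_subr _ _)) //.
rewrite -{1}(subnKC le_i) exprD mulrACA; apply: image_ofM; last first.
  by apply: IHm; rewrite (leq_ltn_trans (leq_subr _ _)).
by apply: image_ofM; [exact/image_ofX/image_of_x | exact: image_of_coef].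
Qed.

(** Expanding (1 - c i) ^+ p turns the sum over the roots into a combination of
    the weighted power sums with coefficients a.+1%:R * 'C(p, j)%:R, while
    [sum_bin_wpsum] writes the binomial sum with 'C(a.+1 * p, j)%:R instead.
    For j > 0 these coefficients agree modulo p ^ 2, and the error stays
    integral
    because at most p factors 1 / x occur, which x ^+ p absorbs. *)
Lemma root_sum_congruence_of_reversed p : prime p -> odd p ->
  exists g, \sum_(1 <= k < p) 'C(a.+1 * k, k)%:R * x ^+ k -
    x ^+ p * (\sum_i a.+1%:R / (a%:R + c i) *
      (a%:R - a%:R * c i ^+ p - a.+1%:R * (1 - c i) ^+ p)) = p%:R ^+ 2 * f g.
Proof.
move=> p_pr p_odd; have p0 := prime_gt0 p_pr.
set S := \sum_(1 <= k < p) _.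
have -> : \sum_i a.+1%:R / (a%:R + c i) *
      (a%:R - a%:R * c i ^+ p - a.+1%:R * (1 - c i) ^+ p) =
    a.+1%:R * (a%:R + a%:R * wpsum p -
       a.+1%:R * \sum_(j < p.+1) 'C(p, j)%:R * wpsum (p - j)).
  (* The constant term a is a times the total weight. *)
  rewrite -[X in a.+1%:R * (X + _ - _)]mulr1.
  rewrite -[X in a.+1%:R * (_ * X + _ - _)]wpsum0 /wpsum.
  under [X in _ - _ * X]eq_bigr => j _ do rewrite mulr_sumr.
  rewrite exchange_big !mulr_sumr -big_split -sumrB mulr_sumr /=.
  apply: eq_bigr => i _.
  have oddN : (- c i) ^+ p = - c i ^+ p
    by rewrite exprNn -signr_odd p_odd mulN1r.
  have -> : (1 - c i) ^+ p = \sum_(j < p.+1) 'C(p, j)%:R * (- c i) ^+ (p - j).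
    rewrite addrC exprDn; apply: eq_bigr => j _.
    by rewrite expr1n mulr1 mulr_natl.
  have -> : \sum_(j < p.+1)
        'C(p, j)%:R * ((a%:R + c i)^-1 * (- c i) ^+ (p - j)) =
      (a%:R + c i)^-1 * \sum_(j < p.+1) 'C(p, j)%:R * (- c i) ^+ (p - j).
    by rewrite mulr_sumr; apply: eq_bigr => j _; rewrite mulrCA.
  rewrite expr0 oddN; ring.
pose e j := (('C(a.+1 * p, j)%:Z - (a.+1 * 'C(p, j))%N%:Z) %/ (p ^ 2)%N%:Z)%Z.
have binE j : (0 < j <= p)%N -> 'C(a.+1 * p, j)%:R =
    a.+1%:R * 'C(p, j)%:R + p%:R ^+ 2 * (e j)%:~R :> L.
  exact: bin_mul_primeE.
pose T := \sum_(j < p) (e j.+1)%:~R * wpsum (p - j.+1).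
(* The terms j = 0 are set apart: there the two coefficients are 1 and a.+1,
   and the difference a is compensated by the term a%:R * wpsum p. *)
have := sum_bin_wpsum p p0; rewrite big_ord_recl bin0 mul1r subn0.
have -> : \sum_(i < p) 'C(a.+1 * p, lift ord0 i)%:R * wpsum (p - lift ord0 i) =
   a.+1%:R * \sum_(i < p) 'C(p, lift ord0 i)%:R * wpsum (p - lift ord0 i) +
   p%:R ^+ 2 * T.
  rewrite !mulr_sumr -big_split; apply: eq_bigr => j _ /=.
  rewrite /bump leq0n add1n binE /=; last exact: ltn_ord.
  by rewrite mulrDl !mulrA.
have -> : 'C(a.+1 * p, p)%:R = a.+1%:R + p%:R ^+ 2 * (e p)%:~R :> L.
  by rewrite binE ?p0 ?leqnn // binn mulr1.
rewrite -/S [X in _ -> exists g, _ - _ * (_ * (_ - _ * X)) = _]big_ord_recl.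
rewrite bin0 mul1r subn0.
move: (\sum_(i < p) _ * _) => U eS.
have -> : S = a%:R * (a.+1%:R + p%:R ^+ 2 * (e p)%:~R) * x ^+ p -
  (x ^+ p * (wpsum p + (a.+1%:R * U + p%:R ^+ 2 * T))) *+ a.+1.
  by rewrite eS subKr.
have [g eg] : image_of f (a%:R * (e p)%:~R * x ^+ p - a.+1%:R * (x ^+ p * T)).
  apply: image_ofB.
    apply: image_ofM; last exact/image_ofX/image_of_x.
    by apply: image_ofM; [exact: image_of_nat | exact: image_of_int].
  apply: image_ofM; first exact: image_of_nat.
  rewrite mulr_sumr; apply: image_of_sum => j _.
  rewrite -{1}(subnKC (ltn_ord j)) exprD mulrACA.
  apply: image_ofM; last exact: image_of_wpsum.
  by apply: image_ofM; [exact/image_ofX/image_of_x | exact: image_of_int].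
exists g; rewrite -eg -[_ *+ a.+1]mulr_natl mulrS; ring.
Qed.
End Series.

(** Injectivity of f says that f 'X is transcendental over the rationals.  It
    forces a + c i <> 0, since at c = - a the polynomial takes the value
    x (- a - 1)^(a+1) + (- a)^a, a polynomial in x with constant term
    (- a)^a <> 0. *)
Lemma root_sum_congruence {L : fieldType} {f : {rmorphism {poly int} -> L}}
    {a p : nat} (c : 'I_a.+1 -> L) :
  injective f -> (0 < a)%N -> prime p -> odd p ->
  f 'X *: ('X - 1) ^+ a.+1 + 'X^a =
    f 'X *: \prod_(i < a.+1) ('X - (c i)%:P) ->
  exists g, \sum_(1 <= k < p) 'C(a.+1 * k, k)%:R * f 'X ^+ k -
    f 'X ^+ p * (\sum_i a.+1%:R / (a%:R + c i) *
      (a%:R - a%:R * c i ^+ p - a.+1%:R * (1 - c i) ^+ p)) = p%:R ^+ 2 * f g.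
Proof.
move=> f_inj a_gt0 p_pr p_odd c_roots.
have f_neq0 h : h != 0 -> f h != 0 by rewrite raddf_eq0.
have aR0 : a%:R != 0 :> int by rewrite pnatr_eq0 -lt0n.
have a0 : a%:R != 0 :> L.
  by rewrite -(rmorph_nat f) f_neq0 // -polyC_natr polyC_eq0.
apply: root_sum_congruence_of_reversed => //.
- by rewrite f_neq0 // polyX_eq0.
- move=> i; apply/eqP => ac_i.
  have := congr1 (horner^~ (- a%:R)) c_roots.
  rewrite hornerZ horner_prod (bigD1 i) //= !hornerE.
  rewrite -[- a%:R - c i]opprD ac_i oppr0.
  rewrite /= mulr0 mul0r -opprD -mulrSr.
  pose h : {poly int} := 'X * (- a.+1%:R)%:P ^+ a.+1 + (- a%:R)%:P ^+ a.
  have -> : f 'X * (- a.+1%:R) ^+ a.+1 + (- a%:R) ^+ a = f h.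
    rewrite /h rmorphD rmorphM !rmorphXn /= !polyCN !polyC_natr !rmorphN /=.
    by rewrite !rmorph_nat.
  apply/eqP/f_neq0/eqP => /(congr1 (fun q : {poly int} => q`_0)).
  rewrite coefD coefXM /= add0r -polyC_exp coefC coef0 /= => /eqP.
  by rewrite expf_eq0 oppr_eq0 (negPf aR0) andbF.
- exact: reverse_factorization.
Qed.

(** * The Gauss valuation of integer polynomials *)

(** This bound is what makes the valuation of a product at most the sum of the
    valuations. *)
Lemma pexp_ndvdzM (p : nat) (u v : int) i j : prime p ->
  ~~ (p%:Z ^+ i.+1 %| u)%Z -> ~~ (p%:Z ^+ j.+1 %| v)%Z ->
  ~~ (p%:Z ^+ (i + j).+1 %| u * v)%Z.
Proof.
move=> p_pr; have [->|u0] := eqVneq u 0; first by rewrite dvdz0.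
have [->|v0] := eqVneq v 0; first by rewrite dvdz0.
rewrite !dvdzE !abszX /= abszM.
rewrite !pfactor_dvdn ?muln_gt0 ?absz_gt0 ?u0 ?v0 // lognM ?absz_gt0 //.
by rewrite -!ltnNge !ltnS; exact: leq_add.
Qed.

Section PadicIntVal.
Context {p : nat} {p_pr : prime p}.
Implicit Types a b : padic_int p_pr.

Lemma residue_eq0_le {a m n} : (m <= n)%N -> a n = 0 -> a m = 0.
Proof. by move=> mn an; rewrite -(residue_le a mn) an mod0z. Qed.

Lemma residue_eq0P a n N : (n <= N)%N ->
  reflect (a n = 0) (p%:Z ^+ n %| a N)%Z.
Proof. by move=> nN; rewrite -(residue_le a nN); exact: dvdz_mod0P. Qed.

Lemma padic_int_val0 : padic_int_val (0 : padic_int p_pr) = +oo%E.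
Proof.
rewrite /padic_int_val; case: pselect => // h; exfalso.
by case: h => n; rewrite residue0 eqxx.
Qed.

Lemma padic_int_val_fin {a m} :
  a m = 0 -> a m.+1 <> 0 -> padic_int_val a = (Posz m)%:E.
Proof.
move=> am am1; rewrite /padic_int_val; case: pselect => [h|[]]; last first.
  by exists m; apply/eqP.
congr (Posz _)%:E; case: ex_minnP => k /eqP ak min_k; apply/eqP.
rewrite eqn_leq min_k; last exact/eqP.
by rewrite leqNgt; apply/negP => /residue_eq0_le /(_ am).
Qed.

Lemma padic_int_valP a : a != 0 ->
  exists m, [/\ a m = 0, a m.+1 <> 0 & padic_int_val a = (Posz m)%:E].
Proof.
move=> /eqP /padic_int_neq0 ex_n; case: (ex_minnP ex_n) => -[|m] /eqP am min_m.
  by have := residue_modz a 0; rewrite expr0 modz1 => /esym.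
have am0 : a m = 0 by apply/eqP/negPn/negP => /min_m; rewrite ltnn.
by exists m; split=> //; exact: padic_int_val_fin.
Qed.

Lemma padic_int_val_fin_num a : a != 0 -> padic_int_val a \is a fin_num.
Proof. by move=> /padic_int_valP [m [_ _ ->]]. Qed.

Lemma padic_int_valM a b :
  padic_int_val (a * b) = (padic_int_val a + padic_int_val b)%E.
Proof.
have [->|/padic_int_valP [i [ai ai1 ->]]] := eqVneq a 0.
  rewrite mul0r padic_int_val0.
  have [->|/padic_int_valP [j [_ _ ->]] //] := eqVneq b 0.
  by rewrite padic_int_val0.
have [->|/padic_int_valP [j [bj bj1 ->]]] := eqVneq b 0.
  by rewrite mulr0 padic_int_val0.
have residueM n : (a * b) n = ((a n * b n) %% p%:Z ^+ n)%Z by [].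
rewrite -EFinD -PoszD; apply: padic_int_val_fin; rewrite residueM.
  apply/dvdz_mod0P; rewrite exprD dvdz_mul //; apply/residue_eq0P => //.
    exact: leq_addr.
  exact: leq_addl.
move/dvdz_mod0P; apply/negP; apply: pexp_ndvdzM => //; apply/residue_eq0P => //.
  by rewrite ltnS leq_addr.
by rewrite ltnS leq_addl.
Qed.

Lemma padic_int_valN a : padic_int_val (- a) = padic_int_val a.
Proof.
have [->|a0] := eqVneq a 0; first by rewrite oppr0.
have [m [am am1 ->]] := padic_int_valP a a0.
have residueN n : (- a) n = ((- a n) %% p%:Z ^+ n)%Z by [].
apply: padic_int_val_fin; rewrite residueN ?am ?mod0z //.
by move/dvdz_mod0P; rewrite rpredN => /(residue_eq0P _ _ _ (leqnn _)).
Qed.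

Lemma padic_int_valD a b :
  (Order.min (padic_int_val a) (padic_int_val b) <= padic_int_val (a + b)%R)%E.
Proof.
have [->|ab0] := eqVneq (a + b) 0; first by rewrite padic_int_val0 leey.
have [m [_ abm1 ->]] := padic_int_valP _ ab0.
rewrite leNgt; apply/negP; rewrite lt_min => /andP[mva mvb]; apply: abm1.
have step (c : padic_int p_pr) :
    ((Posz m)%:E < padic_int_val c)%E -> c m.+1 = 0.
  have [->|c0] := eqVneq c 0; first by rewrite residue0.
  have [k [ck _ ->]] := padic_int_valP c c0.
  by rewrite lte_fin ltz_nat => /residue_eq0_le /(_ ck).
have -> : (a + b) m.+1 = ((a m.+1 + b m.+1) %% p%:Z ^+ m.+1)%Z by [].
by rewrite !step // mod0z.
Qed.

End PadicIntVal.

Section FracVal.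
Context {D : idomainType}.
Local Notation tofrac := (@FracField.tofrac D).

Lemma frac_repr (u : {fraction D}) :
  u = tofrac \n_(repr u) / tofrac \d_(repr u).
Proof.
have d0 := denom_ratioP (repr u).
apply: (canRL (mulfK _)); first by rewrite tofrac_eq0.
rewrite -[u in LHS]reprK /FracField.tofrac; unlock.
rewrite -[LHS]FracField.pi_mul /FracField.mulf.
apply/eqmodP; rewrite /= /equivf /= !numden_Ratio ?mulr1 ?oner_neq0 //.
by rewrite reprK mulrC.
Qed.

Context {v : D -> \bar int}.
Hypotheses (v0 : v 0 = +oo%E) (v_fin : forall a, a != 0 -> v a \is a fin_num).
Hypothesis vM : forall a b, v (a * b)%R = (v a + v b)%E.
Hypothesis vD : forall a b, (Order.min (v a) (v b) <= v (a + b)%R)%E.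

(** A multiplicative v makes frac_val independent of the representative. *)
Lemma frac_val_div n d : d != 0 ->
  frac_val v (tofrac n / tofrac d) = (v n - v d)%E.
Proof.
set u := _ / _ => d0; have e0 := denom_ratioP (repr u).
have : v (n * \d_(repr u)) = v (\n_(repr u) * d).
  congr v; apply/eqP; rewrite -tofrac_eq !tofracM.
  by rewrite -eqr_div ?tofrac_eq0 // -frac_repr.
rewrite !vM /frac_val; move: (v_fin _ d0) (v_fin _ e0).
case: (v d) => [x| |] //; case: (v \d_(repr u)) => [y| |] // _ _.
case: (v n) => [z| |]; case: (v \n_(repr u)) => [t| |] //=.
move=> [zt]; congr EFin; apply/eqP.
by rewrite subr_eq addrAC zt addrK.
Qed.

Lemma frac_val0 : frac_val v 0 = +oo%E.
Proof.
have := frac_val_div 0 1 (oner_neq0 D).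
rewrite tofrac0 mul0r => ->; rewrite v0.
by have := v_fin 1 (oner_neq0 D); case: (v 1).
Qed.

Lemma frac_val_fin_num u : u != 0 -> frac_val v u \is a fin_num.
Proof.
move=> u0; rewrite /frac_val fin_numD fin_numN !v_fin ?denom_ratioP //.
by apply: contraNneq u0 => n0; rewrite (frac_repr u) n0 tofrac0 mul0r.
Qed.

Lemma frac_valD u w :
  (Order.min (frac_val v u) (frac_val v w) <= frac_val v (u + w)%R)%E.
Proof.
rewrite (frac_repr u) (frac_repr w).
move: (repr u) (repr w) => f g.
have f0 := denom_ratioP f; have g0 := denom_ratioP g.
have fg0 : \d_f * \d_g != 0 by rewrite mulf_neq0.
rewrite (_ : _ \n_f / _ = tofrac (\n_f * \d_g) / tofrac (\d_f * \d_g));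
  last by rewrite !tofracM -mulf_div divff ?mulr1 // tofrac_eq0.
rewrite (_ : _ \n_g / _ = tofrac (\d_f * \n_g) / tofrac (\d_f * \d_g));
  last by rewrite !tofracM -mulf_div divff ?mul1r // tofrac_eq0.
rewrite -mulrDl -tofracD !frac_val_div // minEle; case: ifP => le_fg.
  apply: leeB => //; apply: le_trans (vD _ _).
  rewrite le_min lexx /=.
  move: le_fg; move: (v_fin _ fg0); case: (v (_ * _)) => // x _.
  by rewrite leeBrDr // subeK.
apply: leeB => //; apply: le_trans (vD _ _).
rewrite le_min lexx andbT.
move/negbT: le_fg; rewrite -ltNge => /ltW.
by move: (v_fin _ fg0); case: (v (_ * _)) => // x _; rewrite leeBrDr // subeK.
Qed.

Lemma frac_valN u : (forall a, v (- a) = v a) ->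
  frac_val v (- u) = frac_val v u.
Proof.
move=> vN; rewrite {1}(frac_repr u) -mulNr -tofracN.
by rewrite frac_val_div ?denom_ratioP // vN.
Qed.

End FracVal.

Section GaussVal.
Context {K : fieldType} {v : K -> \bar int}.
Hypotheses (v0 : v 0 = +oo%E) (v_fin : forall a, a != 0 -> v a \is a fin_num).
Hypothesis vD : forall a b, (Order.min (v a) (v b) <= v (a + b)%R)%E.
Hypothesis vN : forall a, v (- a) = v a.

Lemma poly_min_val_coef (f : {poly K}) j : (poly_min_val v f <= v f`_j)%E.
Proof.
have [lt_j|le_j] := ltnP j (size f).
  exact: (bigmin_le _ (Ordinal lt_j) (fun i : 'I__ => v f`_i)).
by rewrite (nth_default 0 le_j) v0 leey.
Qed.

Lemma val_mulr_int M a (m : int) : (M <= v a)%E -> (M <= v (a *~ m))%E.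
Proof.
move=> Ma; have nat_case n : (M <= v (a *+ n))%E.
  elim: n => [|n IHn]; first by rewrite mulr0n v0 leey.
  by rewrite mulrS; apply: le_trans (vD _ _); rewrite le_min Ma.
by case: m => n; rewrite ?NegzE ?mulrNz -?pmulrn ?vN nat_case.
Qed.

(** Each coefficient of the product is an integer combination of coefficients of
    d, so the ultrametric inequality bounds its valuation from below. *)
Lemma poly_min_val_int_mul (g : {poly int}) (d : {poly K}) :
  (poly_min_val v d <= poly_min_val v (map_poly intr g * d))%E.
Proof.
apply: le_bigmin => [|j _]; first exact: leey.
rewrite coefM; apply: (big_ind (fun a => _ <= v a)%E) => [|a b Ma Mb|i _].
- by rewrite v0 leey.
- by apply: le_trans (vD _ _); rewrite le_min Ma.
- rewrite coef_map mulrC /= mulrzr; apply: val_mulr_int.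
  exact: poly_min_val_coef.
Qed.

Lemma poly_min_val_fin_num (d : {poly K}) :
  d != 0 -> poly_min_val v d \is a fin_num.
Proof.
move=> d0; have v_gt a : (-oo < v a)%E.
  by have [->|/v_fin] := eqVneq a 0; [rewrite v0|rewrite fin_numElt => /andP[]].
rewrite fin_numElt; apply/andP; split.
  rewrite /poly_min_val; apply: (big_ind (fun a => -oo < a)%E) => // a b Ma Mb.
  by rewrite lt_min Ma.
apply: le_lt_trans (poly_min_val_coef d (size d).-1) _.
have : lead_coef d != 0 by rewrite lead_coef_eq0.
by move/v_fin; rewrite fin_numElt => /andP[].
Qed.

(** If n / d represents the integer polynomial g, then n = g d, so
    [poly_min_val_int_mul] gives v n - v d >= 0. *)
Lemma frac_poly_min_val_int (g : {poly int}) :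
  (0%:E <= frac_val (poly_min_val v) (FracField.tofrac (map_poly intr g)))%E.
Proof.
set u := FracField.tofrac _; have d0 := denom_ratioP (repr u).
rewrite /frac_val sube_ge0; last by rewrite poly_min_val_fin_num.
suff -> : \n_(repr u) = map_poly intr g * \d_(repr u).
  exact: poly_min_val_int_mul.
apply/eqP; rewrite -tofrac_eq tofracM -/u {2}(frac_repr u).
by rewrite divfK ?tofrac_eq0.
Qed.

End GaussVal.

Section GaussPadic.
Context {p : nat} {p_pr : prime p}.

Lemma gauss_val_int_poly (g : {poly int}) :
  (0%:E <=
    gauss_val (FracField.tofrac (map_poly intr g) : padic_ratfun p_pr))%E.
Proof.
have v0 := @padic_int_val0 p p_pr.
have v_fin := @padic_int_val_fin_num p p_pr.
have vM := @padic_int_valM p p_pr; have vD := @padic_int_valD p p_pr.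
have vN := @padic_int_valN p p_pr.
apply: frac_poly_min_val_int => [|a|a b|a].
- exact: frac_val0.
- exact: frac_val_fin_num.
- exact: frac_valD.
- exact: frac_valN.
Qed.

Lemma padic_natr_neq0 n : (0 < n)%N -> n%:R != 0 :> padic p_pr.
Proof.
move=> n0; rewrite -(rmorph_nat (@FracField.tofrac _)) tofrac_eq0.
apply/eqP => /(congr1 (fun a : padic_int p_pr => a n)); rewrite residue0.
have -> : forall m, (m%:R : padic_int p_pr) n = (m%:Z %% p%:Z ^+ n)%Z.
  elim=> [|m IHm]; first by rewrite residue0 mod0z.
  have -> : (m.+1%:R : padic_int p_pr) n =
      ((((1%Z %% p%:Z ^+ n)%Z) + (m%:R : padic_int p_pr) n) %% p%:Z ^+ n)%Z.
    by rewrite mulrS.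
  by rewrite IHm modzDm -PoszD add1n.
rewrite modz_small ?residue0; first by case: n n0.
by rewrite le0z_nat -[Posz p]natz -natrX natz ltz_nat ltn_expl ?prime_gt1.
Qed.

End GaussPadic.

(** * The congruence *)

Theorem theorem16 (p r : nat) (p_pr : prime p) (p_gt2 : (2 < p)%N)
    (r_gt1 : (1 < r)%N)
    (L : fieldExtType (padic_ratfun p_pr)) (c : 'I_r -> L)
    (L_split : splittingFieldFor 1%VS (map_poly (in_alg L) (branch_poly p_pr r))
                 fullv)
    (c_roots : map_poly (in_alg L) (branch_poly p_pr r) =
                 (ratfun_X p_pr)%:A *: \prod_(i < r) ('X - (c i)%:P)) :
  exists B : padic_ratfun p_pr,
    B%:A = (ratfun_X p_pr)%:A ^+ p *
           (\sum_(i < r) r%:R / (r%:R - 1 + c i) *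
              (r%:R - 1 - (r%:R - 1) * c i ^+ p - r%:R * (1 - c i) ^+ p)) :> L
    /\ gauss_eqmod 2 (\sum_(1 <= k < p) 'C(r * k, k)%:R * ratfun_X p_pr ^+ k) B.
Proof.
case: r r_gt1 c L_split c_roots => // a a_gt0 c _.
pose f : {rmorphism {poly int} -> L} :=
  in_alg L \o @FracField.tofrac {poly padic p_pr} \o map_poly intr.
have f_inj : injective f.
  apply: raddf_inj => h /eqP.
  rewrite /= scaler_eq0 oner_eq0 orbF tofrac_eq0 => /eqP h0.
  apply/polyP => i; rewrite coef0.
  have := congr1 (fun q : {poly padic p_pr} => q`_i) h0.
  rewrite coef_map coef0 /=.
  suff nat0 n : n%:R = 0 :> padic p_pr -> n = 0%N.
    case: (h`_i) => n; first by move/nat0 ->.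
    by rewrite NegzE mulrNz -pmulrn => /eqP; rewrite oppr_eq0 => /eqP/nat0.
  by case: n => // n /eqP; rewrite (negPf (padic_natr_neq0 _ _)).
have f_X : f 'X = (ratfun_X p_pr)%:A by rewrite /= map_polyX.
have -> : map_poly (in_alg L) (branch_poly p_pr a.+1) =
    f 'X *: ('X - 1) ^+ a.+1 + 'X^a.
  rewrite rmorphD /= map_polyZ !rmorphXn /= rmorphB /= map_polyX rmorph1.
  by rewrite map_polyX.
rewrite -f_X => c_roots.
have p_odd : odd p by case: (even_prime p_pr) p_gt2 => // ->.
have [g eg] := root_sum_congruence c f_inj a_gt0 p_pr p_odd c_roots.
set S := \sum_(1 <= k < p) _.
pose C : padic_ratfun p_pr := FracField.tofrac (map_poly intr g).
(* The sum over the roots is known to lie in the base field because it differs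
   from S by the base field element p ^ 2 C. *)
exists (S - p%:R ^+ 2 * C); split; last first.
  by exists C; [exact: gauss_val_int_poly | rewrite subKr].
have aE : a.+1%:R - 1 = a%:R :> L by rewrite mulrSr addrK.
have SE : in_alg L S = \sum_(1 <= k < p) 'C(a.+1 * k, k)%:R * f 'X ^+ k.
  rewrite rmorph_sum; apply: eq_bigr => k _.
  by rewrite rmorphM rmorphXn rmorph_nat f_X.
have pCE : in_alg L (p%:R ^+ 2 * C) = p%:R ^+ 2 * f g.
  by rewrite rmorphM rmorphXn rmorph_nat.
by rewrite aE scalerBl [S%:A]SE [X in _ - X]pCE -eg subKr.
Qed.
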